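(* Let $I=[a,b]$ be a compact interval, let $f:I\to\mathbb R$ be absolutely continuous and let $g:I\to\mathbb R$ be a bounded function whose set of points of discontinuity is of (Lebesgue) measure zero. Then both Riemann--Stieltjes integrals $\int_I g\,df$ and $\int_I f\,dg$ exist and $$\int_I g\,df+\int_I f\,dg = g(b)f(b)-g(a)f(a).$$
   Context: For arbitrary functions $g,f:[a,b]\to\mathbb R$, the Riemann--Stieltjes integral $\int_a^b g\,df$ is the limit, as $\delta:=\max_k|t_k-t_{k-1}|\to0$, of the sums $\sum_{k=1}^p g(\tau_k)\,(f(t_k)-f(t_{k-1}))$ over partitions $a=t_0\le t_1\le\dots\le t_p=b$ and points $\tau_k\in[t_{k-1},t_k]$; it is said to exist if a finite limit exists, uniform with respect to the partitions and the intermediate points. No monotonicity or bounded variation is assumed. *)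

(* Defs.v *)
From mathcomp Require Export all_boot all_order all_algebra.
From mathcomp Require Export all_classical all_reals all_analysis.
Export Order.TTheory GRing.Theory Num.Theory.
Export numFieldNormedType.Exports.

Set Implicit Arguments.
Unset Strict Implicit.
Unset Printing Implicit Defensive.

Global Open Scope classical_set_scope.
Global Open Scope ring_scope.

(* A function I -> R on I = [a, b] is represented by a function R -> R; every
   definition below only uses its values on [a, b]. *)

Definition absolutely_continuous_on (R : realType) (a b : R) (f : R -> R) :
    Prop :=
  forall eps : R, 0 < eps -> exists2 delta : R, 0 < delta &
    forall (n : nat) (x y : 'I_n -> R),
      (forall i, [/\ a <= x i, x i <= y i & y i <= b]) ->
      trivIset [set: 'I_n] (fun i => `]x i, y i[%classic) ->
      \sum_(i < n) (y i - x i) < delta ->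
      \sum_(i < n) `|f (y i) - f (x i)| < eps.

(* Continuity is that of the restriction of g to [a, b]: it is one-sided at the
   end points. *)
Definition discontinuities (R : realType) (a b : R) (g : R -> R) : set R :=
  [set x | x \in `[a, b] /\
           ~ {for x, continuous (g : subspace `[a, b] -> R)}].

(* Nodes a = t_0 <= ... <= t_p = b are given by [node 0 .. node p]; the tag in
   [t_k, t_(k+1)] is [tag k], for k < p. Values beyond these are irrelevant. *)
Record tagged_partition (R : realType) (a b : R) := TaggedPartition {
  psize : nat;
  node : nat -> R;
  tag : nat -> R;
  node_first : node 0%N = a;
  node_last : node psize = b;
  node_le : forall k, (k < psize)%N -> node k <= node k.+1;
  tag_in : forall k, (k < psize)%N -> tag k \in `[node k, node k.+1] }.

Definition mesh (R : realType) (a b : R) (P : tagged_partition a b) : R :=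
  \big[Num.max/0]_(k < psize P) `|node P k.+1 - node P k|.

Definition RS_sum (R : realType) (g f : R -> R) (a b : R)
    (P : tagged_partition a b) : R :=
  \sum_(k < psize P) g (tag P k) * (f (node P k.+1) - f (node P k)).

Definition mesh_to0 (R : realType) (a b : R) :
    set_system (tagged_partition a b) :=
  filter_from [set delta : R | 0 < delta]
              (fun delta => [set P | mesh P < delta]).
Arguments mesh_to0 {R} a b.

Definition RS_integrable (R : realType) (a b : R) (g f : R -> R) : Prop :=
  cvg (RS_sum g f P @[P --> mesh_to0 a b]).

Definition RS_integral (R : realType) (a b : R) (g f : R -> R) : R :=
  lim (RS_sum g f P @[P --> mesh_to0 a b]).

Lemma mesh_to0_filter (R : realType) (a b : R) : Filter (mesh_to0 a b).
Proof.
apply: filter_from_filter; first by exists 1 => /=.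
move=> i j /= i0 j0; exists (Num.min i j); first by rewrite /= lt_min i0.
by move=> P /=; rewrite lt_min => /andP[].
Qed.

(* For a <= b the filter is proper, so limits along it are unique. *)
Lemma mesh_to0_proper (R : realType) (a b : R) :
  a <= b -> ProperFilter (mesh_to0 a b).
Proof.
move=> ab; apply: Build_ProperFilter_ex; last exact: mesh_to0_filter.
move=> A [d /= d0 dA].
pose n := Num.truncn ((b - a) / d).
pose t (k : nat) : R := a + (b - a) / n.+1%:R * k%:R.
have n0 : (n.+1%:R : R) != 0 by rewrite pnatr_eq0.
have h0 : 0 <= (b - a) / n.+1%:R by rewrite divr_ge0// subr_ge0.
have tS k : t k.+1 - t k = (b - a) / n.+1%:R.
  by rewrite /t opprD addrACA subrr add0r -mulrBr -natrB// subSnn mulr1.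
have tle k : t k <= t k.+1 by rewrite -subr_ge0 tS.
have t0 : t 0%N = a by rewrite /t mulr0 addr0.
have tn : t n.+1 = b by rewrite /t divfK// subrKC.
have tin k : (k < n.+1)%N -> t k \in `[t k, t k.+1].
  by move=> _; rewrite in_itv /= lexx tle.
exists (TaggedPartition t0 tn (fun k _ => tle k) tin); apply: dA => /=.
rewrite /mesh /=; elim/big_ind: _ => // [x y xd yd|k _].
  by rewrite gt_max xd yd.
rewrite tS ger0_norm// ltr_pdivrMr ?ltr0n// mulrC -ltr_pdivrMr//.
exact: truncnS_gt.
Qed.

(* The limit defining the integral, in epsilon-delta form. *)
Lemma RS_cvgP (R : realType) (a b : R) (g f : R -> R) (l : R) :
  RS_sum g f P @[P --> mesh_to0 a b] --> l <->
  forall eps : R, 0 < eps -> exists2 delta : R, 0 < delta &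
    forall P : tagged_partition a b,
      mesh P < delta -> `|l - RS_sum g f P| < eps.
Proof.
have FF := mesh_to0_filter a b.
by split => [/cvgrPdist_lt//|H]; apply/cvgrPdist_lt.
Qed.

(* Main.v *)
(* The sums of g against df form a Cauchy family. Comparing two fine partitions
   on the intersections of their intervals, the difference of the sums is a sum
   of terms (g s - g t) (f y - f x) with s, t close to ]x, y[. Cover the
   discontinuities of g by an open set U of small measure. The intervals inside
   U contribute little because f is absolutely continuous and g is bounded; on
   the others g oscillates little, while f has bounded variation. The other
   integral is reduced to this one by summation by parts, which exchanges the
   nodes and the tags of a partition. *)

Require Import Defs.
From mathcomp Require Import ring lra.

Set Implicit Arguments.
Unset Strict Implicit.
Unset Printing Implicit Defensive.

(** * Truncation to a segment *)

Section Clamp.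
Variable R : realType.
Implicit Types (s t x y a b : R) (f g : R -> R).

(** For [s <= t], the projection onto [s, t]. Applied to both ends of [x, y] it gives the
    intersection with [s, t], or a degenerate interval when they do not meet. *)
Definition clamp s t x : R := Num.max s (Num.min t x).

Lemma clamp_in s t x : s <= t -> s <= clamp s t x <= t.
Proof. by move=> st; rewrite /clamp le_max lexx ge_max st ge_min lexx. Qed.

Lemma clamp_le s t x y : x <= y -> clamp s t x <= clamp s t y.
Proof.
move=> xy; rewrite /clamp ge_max le_max lexx /= le_max; apply/orP; right.
by rewrite le_min !ge_min lexx xy orbT.
Qed.

Lemma clamp_l s t x : s <= t -> x <= s -> clamp s t x = s.
Proof. by move=> st xs; rewrite /clamp min_r ?max_l// (le_trans xs). Qed.

Lemma clamp_r s t x : s <= t -> t <= x -> clamp s t x = t.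
Proof. by move=> st tx; rewrite /clamp min_l// max_r. Qed.

Lemma clamp_lt_between s t x y z :
  s <= t -> clamp s t x < z < clamp s t y -> (s < z < t) && (x < z < y).
Proof.
move=> st; rewrite /clamp gt_max lt_max !gt_min lt_min.
by case/andP => /andP[sz h] /orP[h'|/andP[zt zy]]; lra.
Qed.

(* Both sides are the increment of f over the intersection of [s, t] and
   [x, y]. *)
Lemma clampC f s t x y : s <= t -> x <= y ->
  f (clamp s t y) - f (clamp s t x) = f (clamp x y t) - f (clamp x y s).
Proof.
move=> st xy.
case: (leP y s) => [ys|sy].
  by rewrite !(clamp_l st) ?(le_trans xy)// !(clamp_r xy) ?(le_trans ys)// !subrr.
case: (leP t x) => [tx|xt].
  by rewrite !(clamp_r st) ?(le_trans tx)// !(clamp_l xy) ?(le_trans st)// !subrr.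
rewrite /clamp; congr (f _ - f _).
  by rewrite minC max_r ?max_r// le_min ?st ?xy ltW.
by rewrite (min_r (ltW xt)) (min_r (ltW sy)) maxC.
Qed.

End Clamp.

(** * Finite disjoint families of intervals and absolute continuity *)

Lemma sum_length_le_measure (R : realType) (T : finType) (x y : T -> R)
    (A : set R) :
  (forall i, x i <= y i) -> trivIset [set: T] (fun i => `]x i, y i[%classic) ->
  measurable A -> (forall i, `]x i, y i[ `<=` A) ->
  ((\sum_i (y i - x i))%:E <= (@lebesgue_measure R) A)%E.
Proof.
move=> xy dis mA sA.
have mI i : measurable (`]x i, y i[%classic : set R) by exact: measurable_itv.
have <- : lebesgue_measure (\bigcup_(i in [set: T]) (`]x i, y i[%classic : set R))
    = (\sum_i (y i - x i))%:E.
  rewrite measure_fin_bigcup//; last exact: finite_finset.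
  have -> : [set: T] = [set` index_enum T].
    by apply/seteqP; split => // i _ /=; rewrite mem_index_enum.
  rewrite -fsbig_seq ?index_enum_uniq// -sumEFin; apply: eq_bigr => i _.
  apply: etrans (lebesgue_measure_itv `]x i, y i[) _.
  rewrite /= lte_fin; case: ltP => [//|yx].
  by rewrite (@le_anti _ _ (x i) (y i)) ?xy ?yx// subrr.
apply: le_measure; rewrite ?inE//.
- by apply: fin_bigcup_measurable => //; exact: finite_finset.
- by apply: bigcup_sub.
Qed.

Section AbsolutelyContinuous.
Variables (R : realType) (a b : R) (f : R -> R).
Hypothesis hf : absolutely_continuous_on a b f.

(** Reindexing along [enum_val] frees the definition from ['I_n]: the cells of two partitions will
    be indexed by pairs. *)
Lemma ac_finType eps : 0 < eps -> exists2 delta : R, 0 < delta &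
  forall (T : finType) (x y : T -> R),
    (forall i, [/\ a <= x i, x i <= y i & y i <= b]) ->
    trivIset [set: T] (fun i => `]x i, y i[%classic) ->
    \sum_i (y i - x i) < delta -> \sum_i `|f (y i) - f (x i)| < eps.
Proof.
move=> /hf[d d0 H]; exists d => // T x y xy dis.
rewrite !(reindex _ (onW_bij _ (enum_val_bij T)))/= => lt.
apply: (H _ (x \o enum_val) (y \o enum_val)) => //=.
move=> i j _ _ ne; apply: enum_val_inj; exact: dis.
Qed.

End AbsolutelyContinuous.

(** * Nodes, tags and mesh of a partition *)

Section Partitions.
Variables (R : realType) (a b : R).
Implicit Types P Q : tagged_partition a b.

Lemma node_mono P i j : (i <= j <= psize P)%N -> node P i <= node P j.
Proof.
case/andP=> ij; elim: j ij => [|j IH]; first by rewrite leqn0 => /eqP ->.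
rewrite leq_eqVlt => /predU1P[-> //|ij jp].
by rewrite (le_trans (IH ij (ltnW jp)))// node_le.
Qed.

Lemma node_in P k : (k <= psize P)%N -> a <= node P k <= b.
Proof.
move=> kp; have := @node_mono P 0 k; have := @node_mono P k (psize P).
by rewrite node_first node_last kp leqnn => -> // ->.
Qed.

Lemma tag_bounds P (k : 'I_(psize P)) : node P k <= tag P k <= node P k.+1.
Proof. by have := tag_in (ltn_ord k); rewrite in_itv. Qed.

Lemma tag_in_ab P (k : 'I_(psize P)) : a <= tag P k <= b.
Proof.
have /andP[h1 h2] := tag_bounds k.
have /andP[h3 _] := node_in (ltnW (ltn_ord k)).
have /andP[_ h4] := node_in (ltn_ord k).
by rewrite (le_trans h3)//= (le_trans h2).
Qed.

Lemma partition_telescope P (F : R -> R) :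
  \sum_(k < psize P) (F (node P k.+1) - F (node P k)) = F b - F a.
Proof.
have := telescope_sumr (F \o node P) (leq0n (psize P)).
by rewrite big_mkord /= node_first node_last.
Qed.

Lemma mesh_ge P (k : 'I_(psize P)) : node P k.+1 - node P k <= mesh P.
Proof.
apply: le_trans (ler_norm _) _.
exact: (le_bigmax_cond _ (fun k : 'I_(psize P) => `|node P k.+1 - node P k|)).
Qed.

Lemma mesh_lt P (d : R) : 0 < d ->
  (forall k : 'I_(psize P), node P k.+1 - node P k < d) -> mesh P < d.
Proof.
move=> d0 H; apply/bigmax_ltP; split=> // k _.
by rewrite ger0_norm ?H// subr_ge0 node_le.
Qed.

Lemma open_cell_inj P (i j : 'I_(psize P)) z :
  node P i < z < node P i.+1 -> node P j < z < node P j.+1 -> i = j.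
Proof.
move=> /andP[iz zi] /andP[jz zj]; apply: val_inj => /=.
case: (ltngtP i j) => // h.
  have : node P i.+1 <= node P j by rewrite node_mono// h ltnW.
  by move=> h'; exfalso; lra.
have : node P j.+1 <= node P i by rewrite node_mono// h ltnW.
by move=> h'; exfalso; lra.
Qed.

(** Exchanging the cell and [x, y] by [clampC] makes the sum telescope along [P] for
    [f \o clamp x y]. *)
Lemma partition_increment P (f : R -> R) x y : a <= x -> x <= y -> y <= b ->
  \sum_(k < psize P) (f (clamp (node P k) (node P k.+1) y) -
                      f (clamp (node P k) (node P k.+1) x)) = f y - f x.
Proof.
move=> ax xy yb.
have := partition_telescope P (f \o clamp x y).
rewrite /= (clamp_r xy yb) (clamp_l xy ax) => <-; apply: eq_bigr => k _.
by rewrite clampC// node_le.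
Qed.

Lemma exists_partition_mesh_lt d : a <= b -> 0 < d ->
  exists P : tagged_partition a b, mesh P < d.
Proof.
move=> ab d0; have FF := mesh_to0_proper ab.
by apply: (@filter_ex _ (mesh_to0 a b)); exists d.
Qed.

End Partitions.

(** * Bounded variation and oscillation *)

Lemma sum_length_le (R : realType) (T : finType) (x y : T -> R) (s t : R) :
  s <= t -> (forall i, [/\ s <= x i, x i <= y i & y i <= t]) ->
  trivIset [set: T] (fun i => `]x i, y i[%classic) ->
  \sum_i (y i - x i) <= t - s.
Proof.
move=> st xy dis; rewrite -lee_fin.
apply: le_trans (sum_length_le_measure (A := `[s, t]%classic) _ dis _ _) _.
- by move=> i; have [] := xy i.
- exact: measurable_itv.
- move=> i z /=; rewrite !in_itv/=; have [h1 h2 h3] := xy i.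
  by move=> /andP[h4 h5]; lra.
rewrite lebesgue_measure_itv/= lte_fin; case: ltP => // ts.
by rewrite lee_fin subr_ge0.
Qed.

Lemma trivIset_itv_sub (R : realType) (T : Type) (x y x' y' : T -> R) :
  (forall i, `]x' i, y' i[ `<=` `]x i, y i[) ->
  trivIset [set: T] (fun i => `]x i, y i[%classic) ->
  trivIset [set: T] (fun i => `]x' i, y' i[%classic).
Proof.
move=> sub dis i j _ _ [z [zi zj]]; apply: dis => //.
by exists z; split; apply: sub.
Qed.

Lemma clamp_itv_sub (R : realType) (s t x y : R) : s <= t ->
  `]clamp s t x, clamp s t y[ `<=` `]x, y[.
Proof.
by move=> st z /=; rewrite !in_itv/= => /(clamp_lt_between st)/andP[].
Qed.

(** Let [d] answer absolute continuity for the bound 1 and let [P] have mesh below [d]. Cutting the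
    given intervals at the nodes of [P] can only increase the sum, and the pieces in one cell have
    total length below [d], so contribute less than 1. Hence [V] is the number of cells. *)
Lemma ac_bounded_variation (R : realType) (a b : R) (f : R -> R) :
  a <= b -> absolutely_continuous_on a b f ->
  exists2 V : R, 0 <= V & forall (T : finType) (x y : T -> R),
    (forall i, [/\ a <= x i, x i <= y i & y i <= b]) ->
    trivIset [set: T] (fun i => `]x i, y i[%classic) ->
    \sum_i `|f (y i) - f (x i)| <= V.
Proof.
move=> ab hf; have [d d0 H] := ac_finType hf ltr01.
have [P Pd] := exists_partition_mesh_lt ab d0.
exists (psize P)%:R => // T x y xy dis.
pose c k := clamp (node P k) (node P k.+1).
have le_sum : \sum_i `|f (y i) - f (x i)| <=
    \sum_i \sum_(k < psize P) `|f (c k (y i)) - f (c k (x i))|.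
  apply: ler_sum => i _; have [h1 h2 h3] := xy i.
  by rewrite -(partition_increment P f h1 h2 h3) ler_norm_sum.
apply: le_trans le_sum _; rewrite exchange_big/=.
have -> : (psize P)%:R = \sum_(k < psize P) 1 :> R by rewrite sumr_const card_ord.
apply: ler_sum => k _; have kle := node_le (ltn_ord k).
have cb i : [/\ node P k <= c k (x i), c k (x i) <= c k (y i) &
                c k (y i) <= node P k.+1].
  have [_ h _] := xy i.
  have /andP[? _] := clamp_in (x i) kle; have /andP[_ ?] := clamp_in (y i) kle.
  by split => //; apply: clamp_le.
have cdis : trivIset [set: T] (fun i => `]c k (x i), c k (y i)[%classic).
  by apply: trivIset_itv_sub dis => i; apply: clamp_itv_sub.
apply/ltW/H => //.
- move=> i; have [h1 h2 h3] := cb i.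
  have /andP[ak _] := node_in (ltnW (ltn_ord k)).
  have /andP[_ kb] := node_in (ltn_ord k).
  by split=> //; [exact: le_trans h1|exact: le_trans kb].
- apply: le_lt_trans (sum_length_le kle cb cdis) _.
  exact: le_lt_trans (mesh_ge k) Pd.
Qed.

(* Lebesgue number argument: compactness of [a, b] makes the choice between
   "inside U" and "small oscillation of g" uniform in the base point. *)
Lemma open_cover_or_small_oscillation (R : realType) (a b : R) (g : R -> R)
    (U : set R) (eta : R) :
  open U -> discontinuities a b g `<=` U -> 0 < eta ->
  exists2 rho : R, 0 < rho & forall z, a <= z <= b ->
    ball z rho `<=` U \/
    forall u v, a <= u <= b -> a <= v <= b -> ball z rho u -> ball z rho v ->
      `|g u - g v| < eta.
Proof.
move=> oU DU eta0.
pose good (rho : R) (z : R) := ball z rho `<=` U \/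
    forall u v, a <= u <= b -> a <= v <= b -> ball z rho u -> ball z rho v ->
      `|g u - g v| < eta.
suff : \forall rho \near (0 : R)^'+, `[a, b]%classic `<=` good rho.
  move=> H; have [rho [Hrho rho0]] :=
    @filter_ex _ _ (at_right_proper_filter (0 : R)) _
      (filterI H (nbhs_right_gt (0 : R))).
  by exists rho => // z zab; apply: Hrho; rewrite /= in_itv.
(* By compactness it suffices that each [z] has a neighbourhood of points [w] satisfying
   [good rho w] for all small [rho > 0]. *)
apply: (compact_near_coveringP `[a, b]%classic).1 => [|z zab].
  exact: segment_compact.
have [r r0 Hr] : exists2 r : R, 0 < r & good r z.
  have [zU|zU] := pselect (U z).
    have /nbhs_ballP[r r0 rU] : nbhs z U by exact: open_nbhs_nbhs.
    by exists r => //; left.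
  have gz : {for z, continuous (g : subspace `[a, b] -> R)}.
    by apply: contrapT => gz; apply: zU; apply: DU.
  have : \forall u \near within `[a, b] (nbhs z), `|g z - g u| < eta / 2.
    rewrite nbhs_subspace_in//.
    by move/cvgrPdist_lt : gz; apply; rewrite divr_gt0.
  rewrite near_withinE => /nbhs_ballP[r r0 Hr].
  exists r => //; right => u v uab vab zu zv.
  have := Hr u zu uab; have := Hr v zv vab; rewrite /= !ltr_norml; lra.
exists (ball z (r / 2), [set rho | rho < r / 2]) => /=.
  split; first by apply: nbhsx_ballx; rewrite divr_gt0.
  by apply: nbhs_right_lt; rewrite divr_gt0.
move=> [w rho] /= [zw rhor].
have sub : ball w rho `<=` ball z r.
  move=> x wx; apply: (@le_ball _ _ z (r / 2 + rho)); last exact: ball_triangle wx.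
  by lra.
case: Hr => [rU|Hr]; [left|right].
  exact: subset_trans rU.
by move=> u v uab vab /sub zu /sub zv; apply: Hr.
Qed.

(** * Comparison of two partitions *)

Section CommonRefinement.
Variables (R : realType) (a b : R) (P Q : tagged_partition a b).
Implicit Types k : 'I_(psize P) * 'I_(psize Q).

(* The cells ]cell_lo k, cell_hi k[ are the intersections of the open intervals
   of P and Q, written ]c, c[ when these do not meet; they replace the ordered
   nodes of a common refinement. *)
Definition cell_lo k : R :=
  clamp (node P k.1) (node P k.1.+1) (node Q k.2).

Definition cell_hi k : R :=
  clamp (node P k.1) (node P k.1.+1) (node Q k.2.+1).

Lemma cell_bounds k :
  [/\ node P k.1 <= cell_lo k, cell_lo k <= cell_hi k &
      cell_hi k <= node P k.1.+1].
Proof.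
have h := node_le (ltn_ord k.1).
have /andP[? _] := clamp_in (node Q k.2) h.
have /andP[_ ?] := clamp_in (node Q k.2.+1) h.
by split=> //; apply/clamp_le/node_le.
Qed.

Lemma cell_bounds_ab k :
  [/\ a <= cell_lo k, cell_lo k <= cell_hi k & cell_hi k <= b].
Proof.
have [h1 h2 h3] := cell_bounds k.
have /andP[ha _] := node_in (ltnW (ltn_ord k.1)).
have /andP[_ hb] := node_in (ltn_ord k.1).
by split=> //; [exact: le_trans h1|exact: le_trans hb].
Qed.

Lemma cell_itv k z : z \in `]cell_lo k, cell_hi k[ ->
  (node P k.1 < z < node P k.1.+1) && (node Q k.2 < z < node Q k.2.+1).
Proof.
by rewrite in_itv; apply/clamp_lt_between/node_le.
Qed.

Lemma cell_disjoint : trivIset setT (fun k => `]cell_lo k, cell_hi k[%classic).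
Proof.
move=> [i j] [i' j'] _ _ [z [/cell_itv/andP[/= zi zj] /cell_itv/andP[/= zi' zj']]].
by congr pair; [exact: open_cell_inj zi zi'|exact: open_cell_inj zj zj'].
Qed.

(** Both sums are split over all cells: the increment of [f] over an interval of [P] telescopes
    along the nodes of [Q], and conversely. *)
Lemma RS_sum_sub (f g : R -> R) : RS_sum g f P - RS_sum g f Q =
  \sum_(k : 'I_(psize P) * 'I_(psize Q))
     (g (tag P k.1) - g (tag Q k.2)) * (f (cell_hi k) - f (cell_lo k)).
Proof.
have -> : RS_sum g f P = \sum_(i < psize P) \sum_(j < psize Q)
    g (tag P i) * (f (cell_hi (i, j)) - f (cell_lo (i, j))).
  apply: eq_bigr => i _; rewrite -mulr_sumr; congr (_ * _).
  have ile := node_le (ltn_ord i).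
  have := partition_telescope Q (f \o clamp (node P i) (node P i.+1)).
  have /andP[ai _] := node_in (ltnW (ltn_ord i)).
  have /andP[_ ib] := node_in (ltn_ord i).
  by rewrite /= clamp_r// clamp_l// => <-.
have -> : RS_sum g f Q = \sum_(i < psize P) \sum_(j < psize Q)
    g (tag Q j) * (f (cell_hi (i, j)) - f (cell_lo (i, j))).
  rewrite exchange_big/=; apply: eq_bigr => j _; rewrite -mulr_sumr; congr (_ * _).
  have jle := node_le (ltn_ord j).
  have /andP[aj _] := node_in (ltnW (ltn_ord j)).
  have /andP[_ jb] := node_in (ltn_ord j).
  by rewrite -(partition_increment P f aj jle jb).
rewrite !pair_big/= -sumrB; apply: eq_bigr => -[i j] _ /=.
by rewrite mulrBl.
Qed.

End CommonRefinement.
Arguments cell_lo {R a b} P Q k.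
Arguments cell_hi {R a b} P Q k.
Arguments cell_disjoint {R a b} P Q.

(** * The Cauchy estimate *)

Lemma RS_sum_cauchy (R : realType) (a b : R) (f g : R -> R) (eps : R) :
  a <= b -> absolutely_continuous_on a b f -> [bounded g x | x in `[a, b]] ->
  (@lebesgue_measure R).-negligible (discontinuities a b g) -> 0 < eps ->
  exists2 rho : R, 0 < rho & forall P Q : tagged_partition a b,
    mesh P < rho -> mesh Q < rho -> `|RS_sum g f P - RS_sum g f Q| < eps.
Proof.
move=> ab hf hg hD eps0.
have [M M0 gM] : exists2 M : R, 0 < M & forall x, a <= x <= b -> `|g x| <= M.
  case: hg => M0 [_ /(_ (`|M0| + 1)) H]; exists (`|M0| + 1); first by rewrite ltr_wpDl.
  move=> x xab; apply: H; rewrite /= ?in_itv//.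
  by rewrite (le_lt_trans (ler_norm _))// ltrDl.
have [V V0 fV] := ac_bounded_variation ab hf.
(* On cells inside [U] the increments of [f] get a factor at most [2 * M], so these cells cost less
   than [eps / 2]. *)
have e1 : 0 < eps / (4 * M) by rewrite divr_gt0// mulr_gt0.
have [d d0 Hd] := ac_finType hf e1.
have [U [oU DU mU]] : exists U : set R, [/\ open U, discontinuities a b g `<=` U &
    (lebesgue_measure U < d%:E)%E].
  case: hD => A [mA A0 DA].
  have Aoo : (lebesgue_measure A < +oo)%E by rewrite A0.
  have [U [oU AU UA]] := lebesgue_regularity_outer mA Aoo d0.
  exists U; split=> //; first exact: subset_trans AU.
  (* Since [A] is null, [U] measures no more than its part outside [A], which outer regularity
     controls. *)
  apply: le_lt_trans UA; have mU := measurable_realfun.open_measurable oU.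
  suff : (lebesgue_measure U <= lebesgue_measure A + lebesgue_measure (U `\` A))%E.
    by rewrite A0 add0e.
  rewrite -[in leLHS](setDUK AU); apply: measureU2 => //; exact: measurableD.
(* The cells of small oscillation cost at most [eta * V], hence at most [eps / 2]; adding 1 keeps
   the denominator positive. *)
pose eta := eps / (2 * (V + 1)).
have eta0 : 0 < eta by rewrite divr_gt0// mulr_gt0// ltr_wpDl.
have [rho rho0 Hrho] := open_cover_or_small_oscillation oU DU eta0.
exists rho => // P Q mP mQ.
pose lo := cell_lo P Q; pose hi := cell_hi P Q.
(* A cell not contained in [U] is collapsed to its right end, where the increment vanishes. Absolute
   continuity then applies to a family indexed by all cells. *)
pose lo' k := if `[< `]lo k, hi k[ `<=` U >] then lo k else hi k.
have lo'E k : (lo' k = lo k /\ `]lo k, hi k[ `<=` U) \/ lo' k = hi k.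
  by rewrite /lo'; case: asboolP => h; [left|right].
have bad : \sum_k `|f (hi k) - f (lo' k)| < eps / (4 * M).
  have sub k : `]lo' k, hi k[ `<=` `]lo k, hi k[.
    by case: (lo'E k) => [[-> _]//|->]; rewrite set_itvoo0; apply: sub0set.
  have dis := trivIset_itv_sub sub (cell_disjoint P Q).
  have lo'hi k : [/\ a <= lo' k, lo' k <= hi k & hi k <= b].
    have [h1 h2 h3] := cell_bounds_ab k.
    by case: (lo'E k) => [[-> _]|->]; split=> //; exact: le_trans h2.
  apply: Hd => //; rewrite -lte_fin; apply: le_lt_trans mU.
  apply: sum_length_le_measure => //.
  - by move=> k; have [] := lo'hi k.
  - exact: measurable_realfun.open_measurable.
  - move=> k; case: (lo'E k) => [[-> ?]//|->].
    by rewrite set_itvoo0; apply: sub0set.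
have all := fV _ _ _ (@cell_bounds_ab _ _ _ P Q) (cell_disjoint P Q).
have term (k : 'I_(psize P) * 'I_(psize Q)) :
      `|(g (tag P k.1) - g (tag Q k.2)) * (f (hi k) - f (lo k))| <=
    eta * `|f (hi k) - f (lo k)| + 2 * M * `|f (hi k) - f (lo' k)|.
  rewrite normrM; have [_ + _] := cell_bounds_ab k.
  (* Tags of intervals that do not overlap may be far apart, but then the cell is degenerate and the
     increment of [f] is 0. *)
  rewrite -/(lo k) -/(hi k) le_eqVlt => /predU1P[e|lohi].
    by rewrite e subrr normr0 !mulr0 add0r mulr_ge0// mulr_ge0// ltW.
  (* The midpoint lies in both intervals, each shorter than [rho]; so both tags and the whole cell
     are within [rho] of it. *)
  have inmid : (lo k + hi k) / 2 \in `]lo k, hi k[.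
    by rewrite in_itv /=; apply/andP; split; lra.
  have /andP[/andP[P1 P2] /andP[Q1 Q2]] := cell_itv inmid.
  have /andP[tP1 tP2] := tag_bounds k.1; have /andP[tQ1 tQ2] := tag_bounds k.2.
  have mPk := mesh_ge k.1; have mQk := mesh_ge k.2.
  have [P3 _ P4] := cell_bounds k; rewrite -/(lo k) -/(hi k) in P3 P4.
  have tPab := tag_in_ab k.1; have tQab := tag_in_ab k.2.
  have /andP[Pa _] := node_in (ltnW (ltn_ord k.1)).
  have /andP[_ Pb] := node_in (ltn_ord k.1).
  have midab : a <= (lo k + hi k) / 2 <= b by apply/andP; split; lra.
  have [inU|osc] := Hrho _ midab.
    have -> : lo' k = lo k.
      rewrite /lo' asboolT// => z; rewrite /= in_itv/= => /andP[z1 z2]; apply: inU.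
      by rewrite /ball/= ltr_norml; apply/andP; split; lra.
    apply: ler_wpDl; first by rewrite mulr_ge0// ltW.
    apply: ler_wpM2r => //; apply: le_trans (ler_normB _ _) _.
    by rewrite mulr_natl mulr2n lerD ?gM.
  apply: ler_wpDr; first by rewrite !mulr_ge0// ltW.
  apply: ler_wpM2r => //; apply/ltW/osc => //.
    by rewrite /ball/= ltr_norml; apply/andP; split; lra.
  by rewrite /ball/= ltr_norml; apply/andP; split; lra.
rewrite RS_sum_sub; apply: le_lt_trans (ler_norm_sum _ _ _) _.
apply: le_lt_trans (ler_sum _ (fun k _ => term k)) _.
rewrite big_split/= -!mulr_sumr.
have -> : eps = eta * (V + 1) + 2 * M * (eps / (4 * M)).
  rewrite /eta; field; lra.
rewrite ler_ltD//.
  by rewrite ler_pM2l// (le_trans all)// lerDl.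
by rewrite ltr_pM2l// mulr_gt0.
Qed.

(** * Summation by parts *)

Section Dual.
Variables (R : realType) (a b : R) (P : tagged_partition a b).

(** [tag P] is arbitrary from index [psize P] on, hence the guard; its default [b] supplies the last
    node. *)
Definition dual_node (k : nat) : R :=
  if k is k'.+1 then if (k' < psize P)%N then tag P k' else b else a.

Lemma dual_node_last : dual_node (psize P).+1 = b.
Proof. by rewrite /= ltnn. Qed.

Lemma dual_node_bounds k : (k <= psize P)%N ->
  dual_node k <= node P k <= dual_node k.+1.
Proof.
move=> kp; apply/andP; split.
  case: k kp => [_|k kp] /=; first by rewrite node_first.
  by rewrite kp; have := tag_in kp; rewrite in_itv => /andP[].
rewrite /=; case: ltnP => [lt|ge].
  by have := tag_in lt; rewrite in_itv => /andP[].
by have /andP[] := node_in kp.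
Qed.

Lemma dual_node_le k : (k < (psize P).+1)%N -> dual_node k <= dual_node k.+1.
Proof. by move=> kp; have /andP[h1 h2] := dual_node_bounds kp; exact: le_trans h2. Qed.

Lemma dual_tag_in k : (k < (psize P).+1)%N ->
  node P k \in `[dual_node k, dual_node k.+1].
Proof. by move=> kp; rewrite in_itv /= dual_node_bounds. Qed.

(* Nodes and tags exchange roles, a and b being added as nodes. *)
Definition dual_partition : tagged_partition a b :=
  @TaggedPartition _ a b (psize P).+1 dual_node (node P) erefl dual_node_last
    dual_node_le dual_tag_in.

(** [node P k] cuts the dual interval of index [k] into two pieces, each inside an interval of [P]
    or reduced to an end point; hence the factor 2. *)
Lemma mesh_dual_lt d : mesh P < d -> mesh dual_partition < 2 * d.
Proof.
move=> Pd; have d0 : 0 < d.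
  by apply: le_lt_trans Pd; apply: bigmax_ge_id.
apply: mesh_lt => [|[k kp]]; first by rewrite mulr_gt0.
have up : dual_node k.+1 - node P k < d.
  rewrite /=; case: ltnP => [lt|ge].
    have /andP[_ h] := tag_bounds (Ordinal lt).
    by have := mesh_ge (Ordinal lt); rewrite /= in h *; lra.
  have -> : k = psize P by apply/eqP; rewrite eqn_leq ge andbT.
  by rewrite node_last subrr.
have dn : node P k - dual_node k < d.
  case: k kp {up} => [|k kp] /=; first by rewrite node_first subrr.
  rewrite ifT//; have /andP[h _] := @tag_bounds _ _ _ P (Ordinal (kp : k < psize P)%N).
  by have := mesh_ge (Ordinal (kp : k < psize P)%N); rewrite /= in h *; lra.
by rewrite /= in up dn *; lra.
Qed.

Lemma RS_sum_by_parts (f g : R -> R) :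
  RS_sum f g P = g b * f b - g a * f a - RS_sum g f dual_partition.
Proof.
rewrite /RS_sum /=; pose t := node P; pose D := dual_node.
have -> : \sum_(k < psize P) f (tag P k) * (g (node P k.+1) - g (node P k)) =
   \sum_(k < psize P) (f (D k.+1) * (g (t k.+1) - g (t k))).
  by apply: eq_bigr => k _; rewrite /D /= ltn_ord.
(* Abel summation, purely algebraic in [t] and [D] and so valid for every [n]. The second sum has
   one more term because the dual partition has one more interval. *)
have step n : \sum_(k < n) (f (D k.+1) * (g (t k.+1) - g (t k))) +
    \sum_(k < n.+1) (g (t k) * (f (D k.+1) - f (D k))) =
    g (t n) * f (D n.+1) - g (t 0%N) * f (D 0%N).
  elim: n => [|n IH]; first by rewrite big_ord0 big_ord1; ring.
  rewrite big_ord_recr [X in _ + X]big_ord_recr/= addrACA IH; ring.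
apply/eqP; rewrite eq_sym subr_eq; apply/eqP.
have := step (psize P); rewrite /t /D dual_node_last node_first node_last.
by move=> ->.
Qed.

End Dual.

Theorem proposition1 (R : realType) (a b : R) (hab : a <= b) (f g : R -> R)
    (hf : absolutely_continuous_on a b f)
    (hg : [bounded g x | x in `[a, b]])
    (hD : (@lebesgue_measure R).-negligible (discontinuities a b g)) :
  [/\ RS_integrable a b g f,
      RS_integrable a b f g &
      RS_integral a b g f + RS_integral a b f g = g b * f b - g a * f a].
Proof.
have FF := mesh_to0_proper hab.
have cgf : RS_integrable a b g f.
  (* By completeness it suffices to find, for each [eps], a real near which all sums over fine
     partitions lie; any one such sum serves. *)
  apply/cauchy_cvgP/cauchy_exP => eps eps0.
  have [rho rho0 H] := RS_sum_cauchy hab hf hg hD eps0.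
  have [P0 mP0] := exists_partition_mesh_lt hab rho0.
  exists (RS_sum g f P0); exists rho => // P mP.
  exact: H.
have cfg : RS_sum f g P @[P --> mesh_to0 a b] -->
    g b * f b - g a * f a - RS_integral a b g f.
  apply/RS_cvgP => eps eps0.
  have [d d0 H] := (RS_cvgP a b g f _).1 cgf eps eps0.
  (* Halving compensates for the doubling of the mesh bound in the dual partition. *)
  exists (d / 2) => [|P mP]; first by rewrite divr_gt0.
  rewrite RS_sum_by_parts opprB addrC addrA subrK -normrN opprB.
  apply: H; have := mesh_dual_lt mP; lra.
split=> //; first by apply/cvg_ex; eexists; exact: cfg.
by rewrite /RS_integral (cvg_lim _ cfg)// subrKC.
Qed.
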